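(* Let $(W,S)$ be a Coxeter system of finite rank with Coxeter matrix $(m(s,t))_{s,t\in S}$. For each pair of elements $s,t$ of $S$ with $m(s,t)<\infty$, let $b(s,t)$ be the largest power of $2$ that divides $m(s,t)$. Let $N_b$ be the normal closure in $W$ of all the elements of the form $(st)^{b(s,t)}$ with $s,t\in S$ and $m(s,t)<\infty$. Then $N_b$ is the normal closure in $W$ of the set of all elements of $W$ of (finite) odd order. Therefore $N_b$ is a characteristic subgroup of $W$ that does not depend on the choice of Coxeter generators $S$ of $W$.
   Context: A Coxeter matrix is a symmetric matrix $M=(m(s,t))_{s,t\in S}$ with each $m(s,t)$ a positive integer or $\infty$, and $m(s,t)=1$ if and only if $s=t$. A Coxeter system with Coxeter matrix $M$ is a pair $(W,S)$ where $W$ is a group generated by $S\subset W$ with presentation $W=\langle S \mid (st)^{m(s,t)} : s,t\in S,\ m(s,t)<\infty\rangle$; then $m(s,t)$ is the order of $st$ in $W$, and $S$ is called a set of Coxeter generators for $W$. The rank of $(W,S)$ is the cardinality of $S$. The number $1=2^0$ counts as a power of $2$. Independence of the choice of $S$ means: if $S'$ is any other set of Coxeter generators of $W$, the subgroup constructed from $S'$ in the same way equals the one constructed from $S$. *)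

(* Defs.v *)
From HB Require Import structures.
From mathcomp Require Import all_boot.
From mathcomp Require Import boolp classical_sets functions cardinality.

Set Implicit Arguments.
Unset Strict Implicit.
Unset Printing Implicit Defensive.

Local Open Scope classical_set_scope.
Local Open Scope group_scope.

(* [None] stands for the entry oo. *)
Definition coxeter_matrix (I : Type) (m : I -> I -> option nat) : Prop :=
  [/\ forall s t, m s t = m t s,
      forall s t n, m s t = Some n -> (0 < n)%N
    & forall s t, m s t = Some 1%N <-> s = t].

(* Words in the letters I and their formal inverses: (s, false) is the letter
   s and (s, true) is its inverse. *)
Definition word (I : Type) := seq (I * bool).

Definition word_eval (I : Type) (G : groupType) (f : I -> G) (w : word I) : G :=
  \prod_(a <- w) (if a.2 then (f a.1)^-1 else f a.1).

(* The congruence on words whose quotient is the group < I | R >, that is, the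
   quotient of the free group on I by the normal closure of R. *)
Inductive word_eq (I : Type) (R : set (word I)) : word I -> word I -> Prop :=
| word_eq_refl u : word_eq R u u
| word_eq_sym u v : word_eq R u v -> word_eq R v u
| word_eq_trans u v w : word_eq R u v -> word_eq R v w -> word_eq R u w
| word_eq_cat u u' v v' :
    word_eq R u u' -> word_eq R v v' -> word_eq R (u ++ v) (u' ++ v')
| word_eq_cancel s e : word_eq R [:: (s, e); (s, ~~ e)] [::]
| word_eq_rel r : R r -> word_eq R r [::].

(* G = < I | R >, the letter i being sent to f i: the evaluation map induces a
   bijection between words modulo [word_eq R] and G. *)
Definition presentation (I : Type) (G : groupType) (f : I -> G)
    (R : set (word I)) : Prop :=
  (forall x, exists w, word_eval f w = x) /\
  (forall u v, word_eval f u = word_eval f v <-> word_eq R u v).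

Definition coxeter_relators (I : Type) (m : I -> I -> option nat) :
    set (word I) :=
  [set r | exists s t n,
     m s t = Some n /\ r = flatten (nseq n [:: (s, false); (t, false)])].

Definition coxeter_system (W : groupType) (S : set W)
    (m : S -> S -> option nat) : Prop :=
  coxeter_matrix m /\
  presentation (fun s : S => \val s) (coxeter_relators m).

Definition subgroup (G : groupType) (H : set G) : Prop :=
  H 1 /\ (forall x y, H x -> H y -> H (x / y)).

Definition normal_subgroup (G : groupType) (H : set G) : Prop :=
  subgroup H /\ (forall x g, H x -> H (x ^ g)).

Definition normal_closure (G : groupType) (A : set G) : set G :=
  smallest (@normal_subgroup G) A.

Definition characteristic_subgroup (G : groupType) (H : set G) : Prop :=
  subgroup H /\
  (forall f : {multiplicative G -> G}, bijective f -> f @` H = H).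

Definition has_order (G : groupType) (x : G) (n : nat) : Prop :=
  [/\ (0 < n)%N, x ^+ n = 1
    & forall k, (0 < k < n)%N -> x ^+ k <> 1].

Definition odd_order_elements (G : groupType) : set G :=
  [set x | exists2 n, odd n & has_order x n].

Definition two_part (n : nat) : nat := (2 ^ logn 2 n)%N.

Definition Nb (W : groupType) (S : set W) (m : S -> S -> option nat) : set W :=
  normal_closure [set x | exists s t n,
    m s t = Some n /\ x = (\val s * \val t) ^+ two_part n].

(* Main.v *)
Require Import Defs.
From HB Require Import structures.
From mathcomp Require Import all_boot.
From mathcomp Require Import boolp classical_sets functions cardinality.

(** The elements [(s t)^b(s,t)] have odd order, because [m(s,t)/b(s,t)] is odd,
    so [Nb m] lies in the normal closure of the elements of odd order
    ([Nb_sub_odd_closure]).  The converse says that [W / Nb m] has no nontrivial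
    element of odd order.  That quotient is generated by involutions, with
    relators [(s t)^b(s,t)] where every [b(s,t)] is a power of 2.  Generators
    with [b(s,t) = 1] become equal; once one letter is kept in each class of
    equal generators, all the remaining exponents are even.

    The heart of the proof is [even_presentation_no_odd_torsion]: a group
    generated by involutions, subject to relators [(s t)^(2^j)] with [j > 0],
    has no odd torsion.  The proof is an induction on the length of a word [w]
    representing an element of odd order.  Let [s] be a letter of [w].  All
    exponents being even, [s |-> 1] and [t |-> 0] for [t <> s] define a
    homomorphism onto Z/2, and it kills an element of odd order: [w] lies in the
    kernel.  By Reidemeister-Schreier this kernel is generated by the
    involutions [t] and [s t s] with [t <> s].  Its relators are the old
    relators not involving [s], their conjugates by [s], and the relators
    [((s t s) t)^(2^(j-1))] coming from [(s t)^(2^j)].  When [j = 1] the last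
    one identifies [s t s] with [t], and the two conjugates share one letter;
    the other relators again have even 2-power exponents.  So the kernel belongs
    to the same class of groups, and [w], rewritten in its generators, has lost
    its letters [s] and become shorter.  The induction therefore runs over all
    such presentations at once.

    An endomorphism of a group maps elements of odd order to elements of odd
    order, and the set of these elements does not mention [S], whence the last
    two assertions. *)

Set Implicit Arguments.
Unset Strict Implicit.
Unset Printing Implicit Defensive.

(** * Presentations by involutions with relators of 2-power exponent *)

Definition wpow (I : Type) (n : nat) (w : seq I) : seq I := flatten (nseq n w).

(** Word equality in the group generated by involutions [s : I] in which
    [(s t)^(2^(k+1)) = 1] whenever [R s t k].  Letters are their own inverses,
    so the words carry no formal inverses.  The shift from [k] to [k+1] keeps
    the exponents even, so that the number of occurrences of a letter is well
    defined modulo 2. *)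
Inductive even_eq (I : Type) (R : I -> I -> nat -> Prop) :
    seq I -> seq I -> Prop :=
| even_eq_refl u : even_eq R u u
| even_eq_sym u v : even_eq R u v -> even_eq R v u
| even_eq_trans u v w : even_eq R u v -> even_eq R v w -> even_eq R u w
| even_eq_cat u u' v v' :
    even_eq R u u' -> even_eq R v v' -> even_eq R (u ++ v) (u' ++ v')
| even_eq_square s : even_eq R [:: s; s] [::]
| even_eq_rel s t k : R s t k -> even_eq R (wpow (2 ^ k.+1) [:: s; t]) [::].

Section WordPowers.
Variable I : Type.
Implicit Types (u v w : seq I) (n : nat).

Lemma wpow_nil n : wpow n [::] = [::] :> seq I.
Proof. by elim: n. Qed.

Lemma wpow_add n k w : wpow (n + k) w = wpow n w ++ wpow k w.
Proof. by rewrite /wpow nseqD flatten_cat. Qed.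

Lemma wpow_mul n k w : wpow (n * k) w = wpow n (wpow k w).
Proof. by elim: n => // n IHn; rewrite mulSn wpow_add IHn. Qed.

Lemma wpow_mul2 n w : wpow (n * 2) w = wpow n (w ++ w).
Proof. by rewrite wpow_mul /wpow /= cats0. Qed.

Lemma map_wpow (J : Type) (f : I -> J) n w :
  map f (wpow n w) = wpow n (map f w).
Proof. by rewrite /wpow map_flatten map_nseq. Qed.

Lemma odd_count_wpow (p : pred I) n w :
  odd (count p (wpow n w)) = odd n && odd (count p w).
Proof.
elim: n => // n IHn; rewrite /wpow /= count_cat oddD -/(wpow n w) IHn.
by case: (odd n); case: (odd _).
Qed.

End WordPowers.

Section EvenEq.
Variables (I : Type) (R : I -> I -> nat -> Prop).
Implicit Types (u v w : seq I) (n : nat).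
Local Notation "u =R v" := (even_eq R u v) (at level 70).

Lemma even_eq_catl u v w : v =R w -> u ++ v =R u ++ w.
Proof. by apply: even_eq_cat; exact: even_eq_refl. Qed.

Lemma even_eq_catr u v w : v =R w -> v ++ u =R w ++ u.
Proof. by move=> ?; apply: even_eq_cat => //; exact: even_eq_refl. Qed.

Lemma even_eq_wpow n u v : u =R v -> wpow n u =R wpow n v.
Proof.
move=> uv; elim: n => [|n IHn]; first exact: even_eq_refl.
exact: even_eq_cat.
Qed.

Lemma even_eq_insert_square s u v : u ++ s :: s :: v =R u ++ v.
Proof. exact/even_eq_catl/(even_eq_catr v (even_eq_square R s)). Qed.

Lemma wpow_conj s n w : wpow n (s :: rcons w s) =R s :: rcons (wpow n w) s.
Proof.
elim: n => [|n IHn]; first by apply: even_eq_sym; exact: even_eq_square.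
rewrite /wpow /= -/(wpow n _) -/(wpow n w).
apply: even_eq_trans (even_eq_catl (s :: rcons w s) IHn) _.
by rewrite /= cat_rcons rcons_cat; exact: (even_eq_insert_square s (s :: w)).
Qed.

Lemma wpow_conj_trivial s n w :
  wpow n w =R [::] -> wpow n (s :: rcons w s) =R [::].
Proof.
move=> wn1; apply: even_eq_trans (wpow_conj s n w) _.
apply: even_eq_trans (even_eq_square R s).
rewrite -cats1; exact: (even_eq_catl [:: s] (even_eq_catr [:: s] wn1)).
Qed.

Lemma wpow_swap_trivial s t n :
  wpow n [:: s; t] =R [::] -> wpow n [:: t; s] =R [::].
Proof.
move=> st1; apply: even_eq_trans (wpow_conj_trivial s st1).
apply/even_eq_wpow/even_eq_sym; exact: (even_eq_insert_square s [::]).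
Qed.

End EvenEq.

(** * The index-two subgroup of words with an even number of letters s *)

Section Doubling.
Variables (I : eqType) (R : I -> I -> nat -> Prop) (s : I).
Implicit Types (t : I) (u v w : seq I) (e : bool).

Local Notation J := (I * bool)%type.

(** [double_letter t e] names [s^e t s^e].  When a relator makes [t] commute
    with [s], the two conjugates are the same element and must get the same
    name: a relator identifying them would have exponent 1, while those of
    [even_eq] have even exponents. *)
Definition double_letter t e : J :=
  (t, e && ~~ `[< R s t 0 \/ R t s 0 >]).

(** Relators for the index-two subgroup.  Conjugating a relator in [t, t'] by
    [s^e] keeps its exponent; a relator [(s t)^(2^(k+2))] becomes
    [((s t s) t)^(2^(k+1))], because [s t s t] is both the square of [s t] and
    the product of the two conjugates of [t].  The letters [(s, e)] do not occur
    in rewritten words; they are harmless because their relators hold when they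
    are read as [s]. *)
Inductive double_rel : J -> J -> nat -> Prop :=
| double_rel_conj t t' k e : R t t' k ->
    double_rel (double_letter t e) (double_letter t' e) k
| double_rel_half t k e : R s t k.+1 \/ R t s k.+1 ->
    double_rel (double_letter t (~~ e)) (double_letter t e) k.

(** Reidemeister-Schreier rewriting: [e] records the parity of the letters [s]
    read so far, so that [s^e w] equals the rewritten word followed by a power
    of [s]. *)
Fixpoint rewrite_word e w : seq J :=
  if w is t :: w' then
    if t == s then rewrite_word (~~ e) w'
    else double_letter t e :: rewrite_word e w'
  else [::].

(** The image of [w] under [s |-> 1], [t |-> 0] in Z/2. *)
Definition parity w := odd (count_mem s w).

Lemma rewrite_word_cat e u v :
  rewrite_word e (u ++ v) = rewrite_word e u ++ rewrite_word (e (+) parity u) v.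
Proof.
rewrite /parity; elim: u e => [|t u IHu] e /=; first by rewrite addbF.
by case: eqP => _ /=; rewrite IHu ?addNb ?addbN.
Qed.

Lemma rewrite_word_wpow e n w : parity w = false ->
  rewrite_word e (wpow n w) = wpow n (rewrite_word e w).
Proof.
move=> w0; elim: n => // n IHn.
by rewrite /wpow /= rewrite_word_cat w0 addbF -/(wpow n w) IHn.
Qed.

Lemma size_rewrite_word e w : size (rewrite_word e w) <= size w.
Proof.
elim: w e => //= t w IHw e; case: eqP => _ /=; last by rewrite ltnS.
exact: leqW (IHw _).
Qed.

(** For [k = 0] the two letters coincide, by the choice made in
    [double_letter], and their product is a square. *)
Lemma half_relator_trivial t e k : R s t k \/ R t s k ->
  even_eq double_rel
    (wpow (2 ^ k) [:: double_letter t (~~ e); double_letter t e]) [::].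
Proof.
case: k => [|k] Rk; last exact/even_eq_rel/double_rel_half.
rewrite /double_letter asboolT // !andbF; exact: even_eq_square.
Qed.

Lemma rewrite_relator e a b k : R a b k ->
  even_eq double_rel (rewrite_word e (wpow (2 ^ k.+1) [:: a; b])) [::].
Proof.
(* (a b)^2, unlike a b, has even parity, so reading it restores the state e. *)
move=> Rab; rewrite expnSr wpow_mul2 rewrite_word_wpow; last first.
  by rewrite /parity /=; case: (a == s); case: (b == s).
rewrite /=; case: eqP => [as_|_]; case: eqP => [bs|_] //=.
- rewrite wpow_nil; exact: even_eq_refl.
- by rewrite negbK; apply: half_relator_trivial; rewrite -as_; left.
- rewrite -{1}[e]negbK; apply: half_relator_trivial; rewrite -bs; by right.
- rewrite -[[:: _, _, _ & _]]/([:: _; _] ++ [:: _; _]) -wpow_mul2 -expnSr.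
  exact/even_eq_rel/double_rel_conj.
Qed.

(** The parity is well defined on group elements because the relators have even
    exponents.  So is the rewriting: reading [(s t)^(2^(k+1))] turns the state
    [e] back to itself and writes the two conjugates of [t] alternately, [2^k]
    times each. *)
Lemma even_eq_rewrite u v : even_eq R u v ->
  parity u = parity v /\
  forall e, even_eq double_rel (rewrite_word e u) (rewrite_word e v).
Proof.
elim=> {u v}.
- by move=> u; split=> // e; exact: even_eq_refl.
- by move=> u v _ [-> uv]; split=> // e; exact: even_eq_sym.
- move=> u v w _ [-> uv] _ [-> vw]; split=> // e.
  exact: even_eq_trans (uv e) (vw e).
- move=> u u' v v' _ [pu uu'] _ [pv vv']; split=> [|e].
    by move: pu pv; rewrite /parity !count_cat !oddD => -> ->.
  by rewrite !rewrite_word_cat pu; exact: even_eq_cat.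
- move=> t; split=> [|e] /=.
    by rewrite /parity /=; case: (t == s).
  case: eqP => _; [exact: even_eq_refl|exact: even_eq_square].
- move=> a b k Rab; split=> [|e]; last exact: rewrite_relator.
  by rewrite /parity odd_count_wpow oddX.
Qed.

Definition letter_word (x : J) : seq I :=
  if x.2 then [:: s; x.1; s] else [:: x.1].

Definition undouble (w : seq J) : seq I := flatten (map letter_word w).

Lemma undouble_cat (u v : seq J) : undouble (u ++ v) = undouble u ++ undouble v.
Proof. by rewrite /undouble map_cat flatten_cat. Qed.

Lemma undouble_wpow n (w : seq J) : undouble (wpow n w) = wpow n (undouble w).
Proof.
by elim: n => // n IHn; rewrite /wpow /= undouble_cat -/(wpow n w) IHn.
Qed.

Lemma letter_word_double t e :
  even_eq R (letter_word (double_letter t e)) (letter_word (t, e)).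
Proof.
rewrite /double_letter; case: asboolP => [comm|_] /=; last first.
  by rewrite andbT; exact: even_eq_refl.
rewrite andbF; case: e; last exact: even_eq_refl.
have tsts : even_eq R (wpow (2 ^ 1) [:: t; s]) [::].
  case: comm => [st|ts]; last exact: even_eq_rel.
  exact/wpow_swap_trivial/even_eq_rel.
(* t = t (t s t s) = s t s *)
apply: even_eq_trans (even_eq_insert_square R t [::] [:: s; t; s]).
exact/even_eq_sym/(even_eq_catl [:: t] tsts).
Qed.

Lemma undouble_pair_trivial n t e t' e' :
  even_eq R (wpow n (letter_word (t, e) ++ letter_word (t', e'))) [::] ->
  even_eq R
    (undouble (wpow n [:: double_letter t e; double_letter t' e'])) [::].
Proof.
apply: even_eq_trans; rewrite undouble_wpow; apply: even_eq_wpow.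
rewrite /undouble [map _ _]/= [flatten _]/= cats0.
by apply: even_eq_cat; exact: letter_word_double.
Qed.

(** The new letters satisfy the relators of [double_rel] when read as the
    conjugates that they name. *)
Lemma even_eq_undouble (u v : seq J) : even_eq double_rel u v ->
  even_eq R (undouble u) (undouble v).
Proof.
elim=> {u v}.
- by move=> u; exact: even_eq_refl.
- by move=> u v _; exact: even_eq_sym.
- by move=> u v w _ uv _; exact: even_eq_trans.
- by move=> u u' v v' _ uu' _ vv'; rewrite !undouble_cat; exact: even_eq_cat.
- move=> [t []]; last exact: even_eq_square.
  apply: even_eq_trans (even_eq_insert_square R s [:: s; t] [:: t; s]) _.
  apply: even_eq_trans (even_eq_insert_square R t [:: s] [:: s]) _.
  exact: even_eq_square.
- move=> _ _ k [t t' {}k e Rtt'|t {}k e Rst]; apply: undouble_pair_trivial.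
    have tt' : even_eq R (wpow (2 ^ k.+1) [:: t; t']) [::].
      exact: even_eq_rel.
    case: e => //; apply: even_eq_trans (wpow_conj_trivial s tt').
    exact/even_eq_wpow/(even_eq_insert_square R s [:: s; t] [:: t'; s]).
  have st : even_eq R (wpow (2 ^ k.+1 * 2) [:: s; t]) [::].
    rewrite -expnSr; case: Rst => [|ts]; first exact: even_eq_rel.
    exact/wpow_swap_trivial/even_eq_rel.
  case: e; rewrite -[_ ++ _]/([:: _; _] ++ [:: _; _]) -wpow_mul2 //.
  exact: wpow_swap_trivial.
Qed.

(** The rewritten word still represents [w], up to the powers of [s] that the
    initial and final states stand for. *)
Lemma undouble_rewrite e w : even_eq R (undouble (rewrite_word e w))
  (nseq e s ++ w ++ nseq (e (+) parity w) s).
Proof.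
elim: w e => [|t w IHw] e.
  rewrite /parity /= addbF; case: e; last exact: even_eq_refl.
  exact/even_eq_sym/even_eq_square.
rewrite /parity /=; case: eqP => [->|_] /=.
  apply: even_eq_trans (IHw _) _; rewrite addbN -addNb.
  case: e => /=; last exact: even_eq_refl.
  exact/even_eq_sym/(even_eq_insert_square R s [::]).
rewrite add0n -/(parity w) -[undouble _]/(letter_word _ ++ undouble _).
apply: even_eq_trans (even_eq_cat (letter_word_double t e) (IHw e)) _.
case: e => /=; last exact: even_eq_refl.
exact: (even_eq_insert_square R s [:: s; t]).
Qed.

End Doubling.

(** Induction on the length of [w], over all presentations at once.  If [s] is
    the first letter of [w] then [w] has an even number of letters [s], since
    its odd power [w^n] has; so [w] lies in the index-two subgroup, where it is
    spelled by a word without the letters [s], hence shorter, and where its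
    [n]-th power is still trivial. *)
Lemma even_presentation_no_odd_torsion (I : eqType)
    (R : I -> I -> nat -> Prop) (n : nat) (w : seq I) :
  odd n -> even_eq R (wpow n w) [::] -> even_eq R w [::].
Proof.
move=> n_odd.
have [l] := ubnP (size w); elim: l => // l IHl in I R w *.
case: w => [|s w] wl wn1; first exact: even_eq_refl.
have [parn rewn] := even_eq_rewrite s wn1.
have par0 : parity s (s :: w) = false.
  by move: parn; rewrite /parity odd_count_wpow n_odd.
have := rewn false; rewrite rewrite_word_wpow // => /IHl w1.
have {}w1 : even_eq (double_rel R s) (rewrite_word R s false (s :: w)) [::].
  apply: w1; rewrite /= eqxx.
  exact: (leq_ltn_trans (size_rewrite_word R s true w) wl).
have := undouble_rewrite R s false (s :: w).
rewrite par0 /= cats0 => /even_eq_sym w_eq.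
exact: even_eq_trans w_eq (even_eq_undouble w1).
Qed.

(** * Normal closures and elements of odd order *)

Local Open Scope classical_set_scope.
Local Open Scope group_scope.

Section NormalSubgroups.
Variable G : groupType.
Implicit Types (A N : set G) (x y z : G).

Lemma normal_closure_normal A : normal_subgroup (normal_closure A).
Proof.
split; [split=> [M [[[]]] //|x y Hx Hy M [nM AM]]|move=> x g Hx M [nM AM]].
  by apply: nM.1.2; [apply: Hx|apply: Hy].
by apply: nM.2; apply: Hx.
Qed.

Lemma odd_order_expg n x : odd n -> x ^+ n = 1 -> odd_order_elements x.
Proof.
move=> n_odd xn1.
have ex : exists k, (0 < k)%N && (x ^+ k == 1).
  by exists n; rewrite odd_gt0 // xn1 eqxx.
case: (ex_minnP ex) => k /andP[k_gt0 /eqP xk1] k_min; exists k; last first.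
  split=> // j /andP[j_gt0 jk] xj1.
  by have := k_min j; rewrite j_gt0 xj1 eqxx leqNgt jk => /(_ isT).
suff kn : (k %| n)%N by apply: dvdn_odd n_odd.
rewrite /dvdn -leqn0 leqNgt; apply/negP => r_gt0.
have : x ^+ (n %% k) == 1.
  move: xn1; rewrite {1}(divn_eq n k) mulnC expgnDr expgnA xk1 expg1n mul1g.
  by move=> ->.
move=> xr1; have := k_min (n %% k)%N.
by rewrite r_gt0 xr1 leqNgt ltn_mod k_gt0 => /(_ isT).
Qed.

Variables (N : set G) (normN : normal_subgroup N).

Lemma normal1 : N 1. Proof. exact: normN.1.1. Qed.

Lemma normalM x y : N x -> N y -> N (x * y).
Proof.
move=> Nx Ny; rewrite -[y]invgK -[y^-1]mul1g.
by apply: normN.1.2 => //; apply: normN.1.2 => //; exact: normal1.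
Qed.

Lemma normalV x : N x -> N x^-1.
Proof. by rewrite -[x^-1]mul1g; apply: normN.1.2; exact: normal1. Qed.

Lemma normal_div_refl x : N (x / x).
Proof. by rewrite mulgV; exact: normal1. Qed.

Lemma normal_div_sym x y : N (x / y) -> N (y / x).
Proof. by move/normalV; rewrite invgF. Qed.

Lemma normal_div_trans y x z : N (x / y) -> N (y / z) -> N (x / z).
Proof. by move=> xy yz; rewrite -(mulgVK y x) -mulgA; exact: normalM. Qed.

Lemma normal_divM x x' y y' : N (x / x') -> N (y / y') -> N (x * y / (x' * y')).
Proof.
move=> xx' yy'; have := normalM xx' (normN.2 _ x'^-1 yy').
by rewrite conjgE invgK invgM !mulgA mulgVK.
Qed.

Lemma normal_divX n x y : N (x / y) -> N (x ^+ n / y ^+ n).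
Proof.
move=> xy; elim: n => [|n IHn]; first exact: normal_div_refl.
by rewrite !expgS; exact: normal_divM.
Qed.

Lemma normal_div_mem x y : N (x / y) -> N y -> N x.
Proof. by move=> xy Ny; rewrite -(mulgVK y x); exact: normalM. Qed.

End NormalSubgroups.

(** * Odd torsion of a Coxeter group *)

Lemma equiv_representatives (T : choiceType) (E : T -> T -> Prop) :
  (forall s, E s s) -> (forall s t, E s t -> E t s) ->
  (forall t s u, E s t -> E t u -> E s u) ->
  exists2 r : T -> T, forall s, E s (r s) & forall s t, E s t -> r s = r t.
Proof.
move=> refl sym trans; exists (fun s => choose (fun t => `[< E s t >]) s).
  by move=> s; apply/asboolP/(@chooseP _ (fun t => `[< E s t >]))/asboolP.
move=> s t st; have sE : (fun u => `[< E s u >]) =1 (fun u => `[< E t u >]).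
  by move=> u; apply/asbool_equiv_eq; split; apply: trans => //; apply: sym.
by rewrite (eq_choose sE); apply: choose_id; apply/asboolP => //; apply: sym.
Qed.

Section OddTorsion.
Variables (W : groupType) (S : set W) (m : S -> S -> option nat).
Hypothesis coxS : coxeter_system m.
Implicit Types (s t : S) (x y : W).

Lemma word_eval_cat (u v : word S) (f : S -> W) :
  word_eval f (u ++ v) = word_eval f u * word_eval f v.
Proof. exact: big_cat. Qed.

Lemma word_eval_wpow n (w : word S) (f : S -> W) :
  word_eval f (wpow n w) = word_eval f w ^+ n.
Proof.
elim: n => [|n IHn]; first by rewrite /word_eval big_nil.
by rewrite /wpow /= word_eval_cat -/(wpow n w) IHn expgS.
Qed.

Lemma coxeter_relation s t n : m s t = Some n -> (val s * val t) ^+ n = 1.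
Proof.
move=> mst; have [_ [_ evalE]] := coxS.
have /evalE : word_eq (coxeter_relators m)
    (wpow n [:: (s, false); (t, false)]) [::].
  by apply: word_eq_rel; exists s, t, n.
rewrite word_eval_wpow /word_eval !big_cons !big_nil /= mulg1.
exact.
Qed.

Lemma coxeter_involution s : val s * val s = 1.
Proof.
have [[_ _ m1] _] := coxS.
by rewrite -[LHS]expg1; apply/coxeter_relation/m1.
Qed.

(** [m(s,t)] is the product of its 2-part and an odd number, which kills
    [(s t)^b(s,t)]. *)
Lemma Nb_sub_odd_closure :
  Nb m `<=` normal_closure (@odd_order_elements W).
Proof.
apply: smallest_sub; first exact: normal_closure_normal.
move=> _ [s [t [n [mst ->]]]]; apply: sub_gen_smallest.
have [[_ m_gt0 _] _] := coxS; have n_gt0 := m_gt0 _ _ _ mst.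
have [q coq nE] := pfactor_coprime (isT : prime 2) n_gt0.
apply: (@odd_order_expg _ q); first by rewrite -coprime2n.
by rewrite -expgnA mulnC -nE coxeter_relation.
Qed.

(** [N] is a normal subgroup containing the generators of [Nb m], and [r] picks
    a representative in each class of generators that are equal modulo [N]. *)
Variables (N : set W) (r : S -> S).
Hypothesis normN : normal_subgroup N.
Hypothesis N_gen : forall s t n,
  m s t = Some n -> N ((val s * val t) ^+ two_part n).
Hypothesis rP : forall s, N (val s / val (r s)).
Hypothesis r_eq : forall s t, N (val s / val t) -> r s = r t.

(** The relators of [W] modulo [N], in the letters chosen by [r].  A pair whose
    exponent has 2-part 1 gives a relator [(r s) (r t)] with [r s = r t], which
    is a square and so is already trivial in [even_eq]. *)
Definition quotient_rel s t k : Prop :=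
  exists s' t' n, [/\ m s' t' = Some n, s = r s', t = r t'
                    & logn 2 n = k.+1].

Definition quotient_word (w : word S) : seq S := [seq r a.1 | a <- w].

(** The relator [(s t)^n] holds because [n] is a multiple of its 2-part [2^j]
    and [(s t)^(2^j)] is trivial: by [quotient_rel] if [j > 0], and as the square of
    the letter [r s = r t] if [j = 0]. *)
Lemma word_eq_quotient (u v : word S) : word_eq (coxeter_relators m) u v ->
  even_eq quotient_rel (quotient_word u) (quotient_word v).
Proof.
elim=> {u v}.
- by move=> u; exact: even_eq_refl.
- by move=> u v _; exact: even_eq_sym.
- by move=> u v w _ uv _; exact: even_eq_trans.
- move=> u u' v v' _ uu' _ vv'.
  by rewrite /quotient_word !map_cat; exact: even_eq_cat.
- by move=> s e; exact: even_eq_square.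
- move=> _ [s [t [n [mst ->]]]].
  rewrite -/(wpow n _) /quotient_word map_wpow /=.
  have [[_ m_gt0 _] _] := coxS; have n_gt0 := m_gt0 _ _ _ mst.
  have [q _ nE] := pfactor_coprime (isT : prime 2) n_gt0.
  rewrite nE wpow_mul -[X in even_eq _ _ X](wpow_nil _ q); apply: even_eq_wpow.
  case logE: (logn 2 n) => [|k]; last by apply: even_eq_rel; exists s, t, n.
  suff -> : r s = r t by exact: even_eq_square.
  apply: r_eq; have := N_gen mst; rewrite /two_part logE expg1.
  by rewrite (mulg1_eq (coxeter_involution t)).
Qed.

Definition seq_eval (u : seq S) : W := \prod_(s <- u) val s.

Lemma seq_eval_wpow n u : seq_eval (wpow n u) = seq_eval u ^+ n.
Proof.
elim: n => [|n IHn]; first by rewrite /seq_eval big_nil.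
by rewrite /wpow /= /seq_eval big_cat /= -/(wpow n u) expgS -IHn.
Qed.

Lemma even_eq_quotient_sound (u v : seq S) :
  even_eq quotient_rel u v -> N (seq_eval u / seq_eval v).
Proof.
elim=> {u v}.
- by move=> u; exact: (normal_div_refl normN).
- by move=> u v _; exact: (normal_div_sym normN).
- by move=> u v w _ uv _; exact: (normal_div_trans normN).
- move=> u u' v v' _ uu' _ vv'; rewrite /seq_eval !big_cat.
  exact: (normal_divM normN).
- move=> s; rewrite /seq_eval !big_cons big_nil mulg1 coxeter_involution.
  exact: (normal_div_refl normN).
- move=> _ _ k [s [t [n [mst -> -> logE]]]].
  rewrite seq_eval_wpow /seq_eval !big_cons !big_nil mulg1 divg1.
  have st_Nb : N ((val s * val t) ^+ (2 ^ k.+1)).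
    by have := N_gen mst; rewrite /two_part logE.
  refine (normal_div_mem normN _ st_Nb).
  apply/(normal_div_sym normN)/(normal_divX normN).
  by apply: (normal_divM normN); exact: rP.
Qed.

Lemma word_eval_quotient (w : word S) :
  N (word_eval (fun s => val s) w / seq_eval (quotient_word w)).
Proof.
elim: w => [|[s e] w IHw]; rewrite /word_eval /seq_eval.
  by rewrite !big_nil; exact: (normal_div_refl normN).
rewrite /= !big_cons; apply: (normal_divM normN) => //=.
have -> : (if e then (val s)^-1 else val s) = val s.
  by case: e => //; exact/mulg1_eq/coxeter_involution.
exact: rP.
Qed.

(** If [w] represents [x], the equation [x^n = 1] survives in the presentation
    with even exponents, so [w] becomes trivial there; reading it back in [W]
    gives [x = 1] modulo [N]. *)
Lemma odd_order_mem x : odd_order_elements x -> N x.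
Proof.
case=> n n_odd [_ xn1 _]; have [_ [surj evalE]] := coxS.
have [w wx] := surj x.
have wn1 : word_eq (coxeter_relators m) (wpow n w) [::].
  by apply/evalE; rewrite word_eval_wpow wx xn1 /word_eval big_nil.
have := word_eq_quotient wn1; rewrite /quotient_word map_wpow.
move=> /(even_presentation_no_odd_torsion n_odd)/even_eq_quotient_sound.
rewrite [seq_eval [::]]big_nil divg1 -wx => Nw.
exact: (normal_div_mem normN (word_eval_quotient w) Nw).
Qed.

End OddTorsion.

Lemma Nb_odd_closure (W : groupType) (S : set W) (m : S -> S -> option nat) :
  coxeter_system m -> Nb m = normal_closure (@odd_order_elements W).
Proof.
move=> coxS; have nN : normal_subgroup (Nb m) by exact: normal_closure_normal.
apply/seteqP; split; first exact: Nb_sub_odd_closure.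
have [r rP r_eq] := @equiv_representatives (set_type S)
  (fun s t => Nb m (val s / val t)) (fun s => normal_div_refl nN _)
  (fun s t => normal_div_sym nN (y := val t))
  (fun t s u => normal_div_trans nN (z := val u)).
apply: smallest_sub => //.
apply: (odd_order_mem coxS nN _ rP r_eq) => s t n mst.
by apply: sub_gen_smallest; exists s, t, n.
Qed.

(** An endomorphism maps an element killed by an odd exponent to another one. *)
Lemma odd_closure_endomorphism (G : groupType) (f : G -> G) x :
  {morph f : y z / y * z} ->
  normal_closure (@odd_order_elements G) x ->
  normal_closure (@odd_order_elements G) (f x).
Proof.
move=> fM; move: x; set H := normal_closure _.
have nH : normal_subgroup H by exact: normal_closure_normal.
have f1 : f 1 = 1 by apply: (mulgI (f 1)); rewrite -fM !mulg1.
have fX n : {morph f : y / y ^+ n}.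
  by move=> y; elim: n => // n IHn; rewrite !expgS fM IHn.
have fV : {morph f : y / y^-1}.
  by move=> y; apply/esym/mulg1_eq; rewrite -fM mulgV.
have preimH : normal_subgroup (f @^-1` H).
  rewrite /preimage; split; first split=> [|y z] /=.
  - by rewrite f1; exact: normal1.
  - by rewrite fM fV; exact: nH.1.2.
  - by move=> y z /= Hy; rewrite !conjgE !fM fV; exact: nH.2.
apply: (smallest_sub preimH) => y [n n_odd [_ yn1 _]]; apply: sub_gen_smallest.
by apply: (odd_order_expg n_odd); rewrite -fX yn1.
Qed.

Lemma odd_closure_characteristic (G : groupType) :
  characteristic_subgroup (normal_closure (@odd_order_elements G)).
Proof.
split=> [|f [g fK gK]]; first exact: (normal_closure_normal _).1.
apply/seteqP; split=> [_ [x Hx <-]|x Hx].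
  exact: odd_closure_endomorphism (@gmulfM _ _ f) Hx.
exists (g x); last exact: gK.
exact: odd_closure_endomorphism (can2_gmulfM fK gK) Hx.
Qed.

Theorem theorem4p2 (W : groupType) (S : set W) (m : S -> S -> option nat)
    (finS : finite_set S) (coxS : coxeter_system m) :
  [/\ Nb m = normal_closure (@odd_order_elements W),
      characteristic_subgroup (Nb m)
    & forall (S' : set W) (m' : S' -> S' -> option nat),
        coxeter_system m' -> Nb m' = Nb m].
Proof.
split; first exact: Nb_odd_closure.
  by rewrite Nb_odd_closure //; exact: odd_closure_characteristic.
by move=> S' m' coxS'; rewrite !Nb_odd_closure.
Qed.
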